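(* Let $X$ be a rearrangement invariant sequence group such that $l_0\subset X\subset l_1$. Then $X$ is an interpolation group with respect to the pair $(l_0,l_1)$ if and only if the following holds: for every constant $C'>0$ there is a constant $C>0$ such that, whenever $b\in X$ and $x\in l_1$ satisfy $$\mathcal K(t,x;l_0,l_1)\le C'\,\mathcal K(t,b;l_0,l_1)\quad\text{for all } t>0,$$ we have $x\in X$ and $\|x\|_X\le C\|b\|_X$ (so $C$ does not depend on $x$ and $b$).
   Context: All sequences are real and indexed by $\mathbb N=\{1,2,\dots\}$. $l_1$ is the group (under coordinatewise addition) of sequences with $\|x\|_{l_1}=\sum_{k}|x_k|<\infty$. $l_0$ is the group of sequences $x$ that are eventually zero, with the quasi-norm $\|x\|_0=\mathrm{card}\{k: x_k\neq 0\}$; $l_0\subset l_1$, so $l_0+l_1=l_1$ and $l_0\cap l_1=l_0$. $(u_k^* )_{k\ge1}$ denotes the nonincreasing rearrangement of $(|u_k|)_{k\ge 1}$. A quasi-norm on an Abelian group $X$ of real sequences (under coordinatewise addition) is a real function $x\mapsto\|x\|_X$ with: (a) $\|x\|_X\ge0$, and $\|x\|_X=0$ iff $x=0$; (b) $\|-x\|_X=\|x\|_X$; (c) $\|x+y\|_X\le c(\|x\|_X+\|y\|_X)$ for some $c\ge1$; then $X$ is a quasi-normed group. $X$ is a rearrangement invariant group if moreover $x_k^*\le y_k^*$ for all $k$ and $y\in X$ imply $x\in X$ and $\|x\|_X\le\|y\|_X$. A homomorphism on a quasi-normed group $X$ is a map $T:X\to X$ with $T(x+y)=Tx+Ty$ and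 $T(-x)=-Tx$; it is bounded in $X$ if $\sup_{x\ne0}\|Tx\|_X/\|x\|_X<\infty$. A quasi-normed group $X$ is an interpolation group with respect to $(l_0,l_1)$ if $l_0\cap l_1\subset X\subset l_0+l_1$ and every homomorphism $T:l_1\to l_1$ that is bounded in $l_1$ and (by restriction, mapping $l_0$ into $l_0$) bounded in $l_0$ also maps $X$ into $X$ and is bounded in $X$. For $x\in l_1$ and $t>0$, Peetre's $\mathcal K$-functional is $\mathcal K(t,x;l_0,l_1):=\inf\{\|x_0\|_0+t\|x_1\|_{l_1}: x=x_0+x_1,\ x_0\in l_0,\ x_1\in l_1\}$. *)

(* Defs.v *)
From mathcomp Require Import all_boot all_order all_algebra.
From mathcomp Require Import finmap.
From mathcomp Require Import all_classical all_reals all_analysis.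
Import Order.TTheory GRing.Theory Num.Theory.
Import numFieldNormedType.Exports.

Set Implicit Arguments.
Unset Strict Implicit.
Unset Printing Implicit Defensive.

Local Open Scope classical_set_scope.
Local Open Scope ring_scope.

(* Sequences are indexed from 0, so [u k] stands for the usual $u_{k+1}$. A
   group of sequences with its quasi-norm is a pair of a set [X] of sequences
   and a function [N] on all sequences; the values of [N] (and of maps defined
   on [X]) outside [X] are irrelevant. *)

Definition l0 (R : realType) : set R^nat :=
  [set x : R^nat | finite_set [set k | x k != 0]].

Definition l0norm (R : realType) (x : R^nat) : R :=
  (#|` fset_set [set k | x k != 0]|%fset)%:R.

Definition l1 (R : realType) : set R^nat :=
  [set x : R^nat | cvgn [series `|x k|]_k].

Definition l1norm (R : realType) (x : R^nat) : R :=
  limn [series `|x k|]_k.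

(* $u^*_{k+1} = \inf\{s \ge 0 : card\{j : |u_j| > s\} \le k\}$. It is taken in
   the extended reals so that an unbounded [u] has $u^* = +\infty$. *)
Definition rearrangement (R : realType) (u : R^nat) (k : nat) : \bar R :=
  ereal_inf [set s%:E | s in
    [set s : R | 0 <= s /\ ([set j | s < `|u j|] #<= `I_k)%card]].

Record quasi_normed_group (R : realType) (X : set R^nat) (N : R^nat -> R) :
    Prop := QuasiNormedGroup {
  qng_zero : X 0;
  qng_add : forall x y, X x -> X y -> X (x + y);
  qng_opp : forall x, X x -> X (- x);
  qng_ge0 : forall x, X x -> 0 <= N x;
  qng_eq0 : forall x, X x -> (N x = 0 <-> x = 0);
  qng_normN : forall x, X x -> N (- x) = N x;
  qng_normD : exists2 c : R, 1 <= c &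
    forall x y, X x -> X y -> N (x + y) <= c * (N x + N y) }.

Record rearrangement_invariant_group (R : realType)
    (X : set R^nat) (N : R^nat -> R) : Prop := RearrangementInvariantGroup {
  rig_qng : quasi_normed_group X N;
  rig_mono : forall x y : R^nat,
    (forall k, (rearrangement x k <= rearrangement y k)%E) ->
    X y -> X x /\ N x <= N y }.

Record homomorphism (R : realType) (X : set R^nat) (T : R^nat -> R^nat) :
    Prop := Homomorphism {
  hom_maps : forall x, X x -> X (T x);
  hom_add : forall x y, X x -> X y -> T (x + y) = T x + T y;
  hom_opp : forall x, X x -> T (- x) = - T x }.

Definition bounded_homomorphism (R : realType)
    (X : set R^nat) (N : R^nat -> R) (T : R^nat -> R^nat) : Prop :=
  homomorphism X T /\
  has_ubound [set N (T x) / N x | x in [set x | X x /\ x <> 0]].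

Record interpolation_group (R : realType) (X : set R^nat) (N : R^nat -> R) :
    Prop := InterpolationGroup {
  itg_qng : quasi_normed_group X N;
  itg_cap : @l0 R `&` @l1 R `<=` X;
  itg_sum : X `<=` [set x0 + x1 | x0 in @l0 R & x1 in @l1 R];
  itg_bounded : forall T : R^nat -> R^nat,
    bounded_homomorphism (@l1 R) (@l1norm R) T ->
    bounded_homomorphism (@l0 R) (@l0norm R) T ->
    bounded_homomorphism X N T }.

Definition Kfunctional (R : realType) (t : R) (x : R^nat) : R :=
  inf [set r | exists x0 x1 : R^nat,
    [/\ l0 x0, l1 x1, x = x0 + x1 & r = l0norm x0 + t * l1norm x1]].

(* Main.v *)
Require Import Defs.
From mathcomp Require Import all_boot all_order all_algebra.
From mathcomp Require Import finmap.
From mathcomp Require Import all_classical all_reals all_analysis.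
From mathcomp Require Import ring lra.
From Stdlib Require Cantor.
Import Order.TTheory GRing.Theory Num.Theory.
Import numFieldNormedType.Exports.

(** Write [x^] for the nonincreasing rearrangement of [|x|] and [S(m)] for its
    tail sum over the indices at least [m]; likewise [B] for a sequence [b].

    From K-monotonicity to interpolation, a decomposition [x = x0 + x1] is
    mapped by [T] to a decomposition of [T x], so the K-functional of [T x] is
    at most a constant times that of [x] ([Kfunctional_homomorphism]), and the
    hypothesis gives the bound on [X].

    The converse rests on two facts.

    First, domination of K-functionals is realised by an operator whose norms
    depend on [C'] only ([exists_operator_of_K_domination]).
    The best way to remove [m] entries from [x] leaves [S(m)] in [l1], so
    choosing [t] of order [n / B(n)] turns the hypothesis into
    [S(M n) <= M B(n)] for all [n], with an integer [M >= 2 C']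
    ([tails_of_K_domination]).  Cutting the rearrangement of [x] into blocks
    of length [M] reduces the problem to two sequences of masses, [b^] and the
    block averages [z], with every tail of [z] below the corresponding tail of
    [b^].  Laying both out as consecutive intervals accumulating at the origin
    gives a transport plan, the mass [b_k] going to [z_j] in proportion to the
    overlap of their intervals.  This preserves [l1], but one [k] may feed
    many [j], which would destroy boundedness in [l0].  That only happens for
    entries with [z_j <= b_j], which are served from [b_j] alone instead; the
    remaining ones have [z_j > b_j >= b_k], hence intervals longer than that
    of [b_k], and at most two of them meet it ([exists_transport]).  The
    outcome is a matrix with bounded entries and boundedly many nonzero
    entries in each column, and such matrices are bounded in both [l0] and
    [l1] ([mxop_bounded]).

    Second, an interpolation group gives a bound for each operator separately,
    not a uniform one.  If no constant [C] worked, there would be, for each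
    [n], a pair [b_n], [x_n] violating the bound with constant [n + 1], and
    matrices [A_n] with [A_n b_n = x_n] and a common bound.  Placing them in
    disjoint copies of the index set inside itself gives a single operator,
    still bounded in [l0] and [l1] ([block_diagonal_bounded]), which maps the
    [n]-th copy of [b_n] to that of [x_n].  Copying does not change the
    rearrangement, hence neither membership in [X] nor the quasi-norm, and the
    bound of this one operator on [X] is contradicted for large [n]
    ([interpolation_Kmonotone]). *)

Set Implicit Arguments.
Unset Strict Implicit.
Unset Printing Implicit Defensive.

Local Open Scope classical_set_scope.
Local Open Scope ring_scope.

(** * Series of nonnegative terms and rearrangement of indices *)

Section NonnegativeSeries.
Context {R : realType}.
Implicit Types (f g : R^nat) (p : nat -> nat) (s t : seq nat).

Lemma sum_uniq_le f s : (forall k, 0 <= f k) -> cvgn (series f) -> uniq s ->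
  \sum_(k <- s) f k <= limn (series f).
Proof.
move=> f0 cf us; set N := (\max_(k <- s) k).+1.
have sN k : k \in s -> (k < N)%N.
  by move=> ks; rewrite ltnS leq_bigmax_seq.
apply: le_trans (_ : series f N <= _); last first.
  by apply: nondecreasing_cvgn_le => //; exact: nondecreasing_series.
rewrite /series /= [leRHS](bigID (fun k => k \in s)) /= -[leLHS]addr0.
apply: lerD; last exact: sumr_ge0.
rewrite -[leRHS]big_filter (perm_big [seq k <- index_iota 0 N | k \in s]) //.
apply: uniq_perm => //.
  by rewrite filter_uniq // iota_uniq.
move=> k; rewrite mem_filter mem_index_iota /=.
by case: (boolP (k \in s)) => // /sN ->.
Qed.

Lemma series_le_bound f c : (forall k, 0 <= f k) ->
  (forall n, series f n <= c) -> cvgn (series f) /\ limn (series f) <= c.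
Proof.
move=> f0 fc; have cf : cvgn (series f).
  apply: nondecreasing_is_cvgn; first exact: nondecreasing_series.
  by exists c => _ [n _ <-].
by split=> //; apply: limr_le => //; exact: nearW.
Qed.

Lemma lim_series_ge0 f : (forall k, 0 <= f k) -> cvgn (series f) ->
  0 <= limn (series f).
Proof.
by move=> f0 cf; have := @sum_uniq_le f [::] f0 cf isT; rewrite big_nil.
Qed.

Lemma sum_injective_le f p n : (forall k, 0 <= f k) -> cvgn (series f) ->
  injective p -> series (f \o p) n <= limn (series f).
Proof.
move=> f0 cf ip.
rewrite /series /= (_ : \sum_(0 <= k < n) f (p k) =
  \sum_(k <- map p (index_iota 0 n)) f k); last by rewrite big_map.
by apply: sum_uniq_le => //; rewrite map_inj_uniq // iota_uniq.
Qed.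

(** Every finite sum of either series is a finite sum of the other one along
    distinct indices, so each limit bounds the other. *)
Lemma reindex_series_nonneg f p : (forall k, 0 <= f k) -> injective p ->
  (forall k, f k != 0 -> exists i, p i = k) -> cvgn (series (f \o p)) ->
  cvgn (series f) /\ limn (series f) = limn (series (f \o p)).
Proof.
move=> f0 ip fp cfp; have fp0 k : 0 <= (f \o p) k by exact: f0.
have /choice[q qP] : forall k, exists i, f k != 0 -> p i = k.
  move=> k; have [fk0|/fp[i pik]] := eqVneq (f k) 0; last by exists i.
  by exists 0%N.
have bnd n : series f n <= limn (series (f \o p)).
  rewrite /series /= (bigID (fun k => f k == 0)) /= big1 ?add0r; last first.
    by move=> k /eqP.
  rewrite -big_filter; set s := [seq _ <- _ | _].
  have sf k : k \in s -> f k != 0 by rewrite mem_filter => /andP[].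
  rewrite (_ : \sum_(k <- s) f k = \sum_(k <- map q s) (f \o p) k); last first.
    by rewrite big_map; apply: eq_big_seq => k /sf fk /=; rewrite qP.
  apply: sum_uniq_le => //; rewrite map_inj_in_uniq.
    by rewrite filter_uniq // iota_uniq.
  by move=> k l /sf fk /sf fl qkl; rewrite -(qP k) // -(qP l) // qkl.
have [cf le1] := series_le_bound f0 bnd; split=> //.
apply/eqP; rewrite eq_le le1 /=.
by apply: (series_le_bound fp0 _).2 => n; exact: sum_injective_le.
Qed.

(** The signed case follows from the nonnegative one applied to [|f|] and
    [|f| + f]. *)
Lemma reindex_series f p : injective p ->
  (forall k, f k != 0 -> exists i, p i = k) ->
  cvgn (series (fun k => `|f k|)) ->
  limn (series f) = limn (series (f \o p)).
Proof.
move=> ip fp cn.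
have cp : cvgn (series (fun k => `|f (p k)|)).
  apply: (proj1 (@series_le_bound (fun k => `|f (p k)|)
    (limn (series (fun k => `|f k|))) _ _)) => // n.
  exact: (@sum_injective_le (fun k => `|f k|)).
have [|_ en] := @reindex_series_nonneg (fun k => `|f k|) p
  (fun _ => normr_ge0 _) ip _ cp.
  by move=> k; rewrite normr_eq0; exact: fp.
have cfp : cvgn (series (f \o p)) by exact: normed_cvg.
have cf : cvgn (series f) by exact: normed_cvg.
set g := fun k => `|f k| + f k.
have cg : cvgn (series (g \o p)) by exact: (is_cvg_seriesD cp cfp).
have [||_] := @reindex_series_nonneg g p _ ip _ cg.
- by move=> k; rewrite /g -lerBlDr sub0r ler_normr lexx orbT.
- move=> k gk; apply: fp; apply: contraNneq gk => fk.
  by rewrite /g fk normr0 addr0.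
by rewrite (lim_seriesD cn cf) (lim_seriesD cp cfp) en => /addrI.
Qed.

End NonnegativeSeries.

(** * The spaces l0 and l1, and matrices bounded on both *)

Section SequenceSpaces.
Context {R : realType}.
Implicit Types (x y u : R^nat) (s : seq nat).

Lemma l0_support x : l0 x -> exists s,
  [/\ uniq s, forall k, (k \in s) = (x k != 0) & l0norm x = (size s)%:R].
Proof.
move=> fx; exists (enum_fset (fset_set [set k | x k != 0])); split=> //.
  exact: fset_uniq.
by move=> k; rewrite in_fset_set //; apply/idP/idP; rewrite inE.
Qed.

Lemma l0_le_size x s : (forall k, x k != 0 -> k \in s) ->
  l0 x /\ l0norm x <= (size s)%:R.
Proof.
move=> xs; have fx : l0 x.
  by apply: (sub_finite_set _ (finite_seq s)) => k /= /xs.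
split=> //; have [t [ut tx ->]] := l0_support fx.
by rewrite ler_nat uniq_leq_size // => k; rewrite tx => /xs.
Qed.

Lemma l0norm_ge0 x : 0 <= l0norm x.
Proof. exact: ler0n. Qed.

Lemma l1norm_ge0 x : l1 x -> 0 <= l1norm x.
Proof. by move=> lx; exact: (@lim_series_ge0 R (fun k => `|x k|)). Qed.

Lemma l1_0 : l1 (0 : R^nat).
Proof.
apply: (@series_le_bound R (fun k => `|_|) 0 _ _).1 => // n.
by rewrite /series /= big1 // => k _; rewrite normr0.
Qed.

Lemma l1norm0 : l1norm (0 : R^nat) = 0.
Proof.
apply/eqP; rewrite eq_le (l1norm_ge0 l1_0) andbT.
apply: (@series_le_bound R (fun k => `|_|) 0 _ _).2 => // n.
by rewrite /series /= big1 // => k _; rewrite normr0.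
Qed.

Lemma l0_0 : l0 (0 : R^nat).
Proof. by apply: (@l0_le_size _ [::] _).1 => k; rewrite eqxx. Qed.

Lemma l0norm0 : l0norm (0 : R^nat) = 0.
Proof.
apply/eqP; rewrite eq_le l0norm_ge0 andbT.
by apply: (@l0_le_size _ [::] _).2 => k; rewrite eqxx.
Qed.

Lemma l0_sub_l1 x : l0 x -> l1 x.
Proof.
move=> /l0_support[s [us sx _]].
apply: (@series_le_bound R (fun k => `|x k|)
  (\sum_(k <- s) `|x k|) _ _).1 => // n.
rewrite /series /= [leLHS](bigID (fun k => k \in s)) /=.
rewrite [X in _ + X]big1; last first.
  by move=> k; rewrite sx negbK => /eqP ->; rewrite normr0.
rewrite addr0 [leRHS](bigID (fun k => (k < n)%N)) /= -[leLHS]addr0.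
apply: lerD; last exact: sumr_ge0.
rewrite -[leLHS]big_filter -[leRHS]big_filter.
rewrite (perm_big [seq k <- s | (k < n)%N]) //; apply: uniq_perm.
- by rewrite filter_uniq // iota_uniq.
- by rewrite filter_uniq.
by move=> k; rewrite !mem_filter mem_index_iota andbC.
Qed.

Lemma l1norm_gt0 x : l1 x -> x <> 0 -> 0 < l1norm x.
Proof.
move=> lx x0; have [k xk] : exists k, x k != 0.
  apply: contrapT => nx; apply: x0; apply/funext => k.
  by apply/eqP; apply: contrapT => /negP xk; apply: nx; exists k.
apply: lt_le_trans (_ : `|x k| <= _); first by rewrite normr_gt0.
have := @sum_uniq_le R (fun k => `|x k|) [:: k] (fun _ => normr_ge0 _) lx isT.
by rewrite big_seq1.
Qed.

Lemma l0norm_gt0 x : l0 x -> x <> 0 -> 0 < l0norm x.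
Proof.
move=> /l0_support[s [us sx ->]] x0; rewrite ltr0n lt0n size_eq0.
apply: contra_notN x0 => /eqP s0; apply/funext => k.
by apply/eqP; rewrite -[_ == _]negbK -sx s0.
Qed.

End SequenceSpaces.

Section ColumnBoundedMatrices.
Context {R : realType}.
Implicit Types (A : nat -> nat -> R) (u v : R^nat) (L : nat).

(** A single integer bounds both the entries and the number of nonzero entries
    per column: this makes a matrix act boundedly on [l0] and on [l1], and
    it is stable under direct sums with no loss in the bound. *)
Definition bounded_columns A L : Prop :=
  (forall j k, `|A j k| <= L%:R) /\
  (forall k, exists2 s : seq nat,
     (size s <= L)%N & forall j, A j k != 0 -> j \in s).

Definition mxop A u : R^nat := fun j => limn (series (fun k => A j k * u k)).

Lemma row_summable A L u j : bounded_columns A L -> l1 u ->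
  cvgn (series (fun k => `|A j k * u k|)).
Proof.
move=> [AL _] lu.
apply: (series_le_cvg _ _ _ (@is_cvg_seriesZ _ (fun k => `|u k|) L%:R lu)).
- by move=> k.
- by move=> k; rewrite mulr_ge0.
- by move=> k; rewrite normrM ler_wpM2r.
Qed.

Lemma row_cvg A L u j : bounded_columns A L -> l1 u ->
  cvgn (series (fun k => A j k * u k)).
Proof. by move=> AL lu; apply: normed_cvg; exact: row_summable AL lu. Qed.

Lemma column_sum_le A L k n : bounded_columns A L ->
  \sum_(0 <= j < n) `|A j k| <= (L * L)%:R.
Proof.
move=> [AL /(_ k)[s sL sA]].
rewrite (bigID (fun j => A j k == 0)) /= big1 ?add0r; last first.
  by move=> j /eqP ->; rewrite normr0.
rewrite -big_filter; set t := [seq _ <- _ | _].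
apply: le_trans (_ : \sum_(j <- t) L%:R <= _); first by apply: ler_sum.
rewrite big_const_seq count_predT iter_addr_0 -mulrnA ler_nat.
rewrite leq_mul2l (leq_trans _ sL) ?orbT // uniq_leq_size //.
  by rewrite filter_uniq // iota_uniq.
by move=> j; rewrite mem_filter => /andP[/sA].
Qed.

Lemma sum_lim_series (F : nat -> R^nat) n : (forall j, cvgn (series (F j))) ->
  cvgn (series (fun k => \sum_(0 <= j < n) F j k)) /\
  limn (series (fun k => \sum_(0 <= j < n) F j k)) =
    \sum_(0 <= j < n) limn (series (F j)).
Proof.
move=> cF; elim: n => [|n [cn en]].
  rewrite big_nil (_ : series _ = fun=> 0); last first.
    by apply/funext => m; rewrite /series /= big1 // => k _; rewrite big_nil.
  by split; [exact: is_cvg_cst | exact: lim_cst].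
rewrite (_ : (fun k => \sum_(0 <= j < n.+1) F j k) =
  (fun k => \sum_(0 <= j < n) F j k) + F n); last first.
  by apply/funext => k; rewrite big_nat_recr.
by split; [exact: is_cvg_seriesD | rewrite lim_seriesD // en big_nat_recr].
Qed.

(** Only finitely many rows are summed at a time, so exchanging the two sums
    amounts to linearity of limits; the columns of [|A|] sum to at most
    [L * L]. *)
Lemma mxop_l1 A L u : bounded_columns A L -> l1 u ->
  l1 (mxop A u) /\ l1norm (mxop A u) <= (L * L)%:R * l1norm u.
Proof.
move=> AL lu; apply: (@series_le_bound R (fun j => `|mxop A u j|)) => // n.
have cr j := @row_summable A L u j AL lu.
apply: le_trans
  (_ : \sum_(0 <= j < n) limn (series (fun k => `|A j k * u k|)) <= _).
  rewrite [leLHS]/series /=; apply: ler_sum => j _.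
  exact: (lim_series_norm (cr j)).
have [cS <-] := sum_lim_series n cr.
have -> : (L * L)%:R * l1norm u =
    limn (series ((L * L)%:R *: (fun k => `|u k|) : R^nat)).
  by rewrite lim_seriesZ.
apply: lim_series_le => //; first exact: is_cvg_seriesZ.
move=> k; under eq_bigr do rewrite normrM.
by rewrite -mulr_suml ler_wpM2r // (column_sum_le _ _ AL).
Qed.

(** The image is supported in the union of the column supports attached to the
    support of [u]. *)
Lemma mxop_l0 A L u : bounded_columns A L -> l0 u ->
  l0 (mxop A u) /\ l0norm (mxop A u) <= L%:R * l0norm u.
Proof.
move=> [_ AL] /l0_support[s [us su ->]].
have /choice[c cP] : forall k, exists t : seq nat,
    (size t <= L)%N /\ forall j, A j k != 0 -> j \in t.
  by move=> k; have [t ? ?] := AL k; exists t.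
have [] := @l0_le_size R (mxop A u) (flatten [seq c k | k <- s]).
  move=> j; apply: contraNT => jc; rewrite /mxop (_ : (fun k => _) = 0).
    by rewrite (_ : series _ = fun=> 0) ?lim_cst //; apply/funext => n;
       rewrite /series /= big1.
  apply/funext => k /=; apply/eqP; rewrite mulf_eq0 -[_ || _]negbK negb_or.
  apply: contra jc => /andP[Ajk uk]; apply/flattenP; exists (c k).
    by apply: map_f; rewrite su.
  exact: (cP k).2.
move=> l0Au /le_trans le; split=> //; apply: le; rewrite -natrM ler_nat.
rewrite size_flatten /shape -map_comp; elim: s {us su} => [|k s IH] /=.
  by rewrite muln0.
by rewrite mulnS leq_add // (cP k).1.
Qed.

Lemma bounded_homomorphismI (X : set R^nat) (N : R^nat -> R) T c :
  homomorphism X T -> (forall x, X x -> x <> 0 -> 0 < N x) ->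
  (forall x, X x -> N (T x) <= c * N x) -> bounded_homomorphism X N T.
Proof.
move=> hT N0 TN; split=> //; exists c => _ [x /= [Xx x0] <-].
by rewrite ler_pdivrMr ?N0 // TN.
Qed.

Lemma mxopD A L u v : bounded_columns A L -> l1 u -> l1 v ->
  mxop A (u + v) = mxop A u + mxop A v.
Proof.
move=> AL lu lv; apply/funext => j.
rewrite /mxop -[RHS](lim_seriesD (row_cvg AL lu) (row_cvg AL lv)).
by congr (limn (series _)); apply/funext => k; rewrite /= mulrDr.
Qed.

Lemma mxopN A L u : bounded_columns A L -> l1 u -> mxop A (- u) = - mxop A u.
Proof.
move=> AL lu; apply/funext => j.
rewrite /mxop -[RHS](lim_seriesN (row_cvg AL lu)).
by congr (limn (series _)); apply/funext => k; rewrite /= mulrN.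
Qed.

Lemma mxop_bounded A L : bounded_columns A L ->
  bounded_homomorphism (@l1 R) (@l1norm R) (mxop A) /\
  bounded_homomorphism (@l0 R) (@l0norm R) (mxop A).
Proof.
move=> AL; split.
  apply: (@bounded_homomorphismI _ _ _ (L * L)%:R).
  - split=> [u lu|u v|u]; first exact: (mxop_l1 AL lu).1.
      exact: mxopD AL.
    exact: mxopN AL.
  - exact: l1norm_gt0.
  - by move=> u lu; exact: (mxop_l1 AL lu).2.
apply: (@bounded_homomorphismI _ _ _ L%:R).
- split=> [u lu|u v lu lv|u lu]; first exact: (mxop_l0 AL lu).1.
    by rewrite (mxopD AL) //; exact: l0_sub_l1.
  by rewrite (mxopN AL) //; exact: l0_sub_l1.
- exact: l0norm_gt0.
- by move=> u lu; exact: (mxop_l0 AL lu).2.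
Qed.

End ColumnBoundedMatrices.

(** * Decreasing enumerations and tail sums *)

Section DecreasingEnumeration.
Context {R : realType}.
Implicit Types (x u : R^nat) (p : nat -> nat).

Lemma exists_argmax_notin x (s : seq nat) : l1 x ->
  exists k, k \notin s /\ forall j, j \notin s -> `|x j| <= `|x k|.
Proof.
move=> lx; have [[j0 [j0s xj0]]|none] :=
    pselect (exists j, j \notin s /\ x j != 0); last first.
  exists (\max_(k <- s) k).+1; split.
    by apply/negP => /(@leq_bigmax_seq _ s predT id) /(_ isT); rewrite ltnn.
  move=> j js; have [->|xj] := eqVneq (x j) 0; first by rewrite normr0.
  by case: none; exists j.
have /cvgrPdist_lt/(_ `|x j0|) [|N _ xN] := cvg_series_cvg_0 lx.
  by rewrite normr_gt0.
have small k : (N <= k)%N -> `|x k| < `|x j0|.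
  by move=> /xN; rewrite sub0r normrN normr_id.
have j0N : (j0 < N)%N by rewrite ltnNge; apply/negP => /small; rewrite ltxx.
case: (@arg_maxP _ _ _ (Ordinal j0N) (fun i : 'I_N => val i \notin s)
  (fun i : 'I_N => `|x i|) j0s) => i si imax.
exists (val i); split=> // j js; have [jN|Nj] := ltnP j N.
  exact: (imax (Ordinal jN)).
by apply: le_trans (ltW (small _ Nj)) _; exact: (imax (Ordinal j0N)).
Qed.

(** Then [i |-> |x (p i)|] is the nonincreasing rearrangement of [|x|].
    Since [p] is total, it may also visit zeros of [x], and when the support of
    [x] is infinite it visits no zero at all; only the support is covered. *)
Record decreasing_enumeration x p : Prop := DecreasingEnumeration {
  denum_inj : injective p;
  denum_mono : forall i j, (i <= j)%N -> `|x (p j)| <= `|x (p i)|;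
  denum_support : forall k, x k != 0 -> exists i, p i = k }.

(** Greedy choice: [p n] is an index of largest modulus among those not yet
    visited.  A nonzero entry never visited would bound all the chosen
    entries from below, which contradicts summability. *)
Lemma exists_decreasing_enumeration x :
  l1 x -> exists p, decreasing_enumeration x p.
Proof.
move=> lx; have /choice[nxt nxtP] := fun s => @exists_argmax_notin x s lx.
pose pre n := iter n (fun s => rcons s (nxt s)) [::].
pose p n := nxt (pre n).
have preE n : pre n = [seq p i | i <- iota 0 n].
  elim: n => // n IH; rewrite -addn1 iotaD map_cat cats1 addn1 -IH.
  by rewrite /pre iterS.
have pN n : p n \notin pre n by exact: (nxtP _).1.
have pin i j : (i < j)%N -> p i \in pre j.
  by move=> ij; rewrite preE map_f // mem_iota.
have ip : injective p.
  have H i j : (i < j)%N -> p i <> p j.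
    by move=> /pin pij e; have := pN j; rewrite -e pij.
  by move=> i j e; case: (ltngtP i j) => // /H; rewrite e.
exists p; split=> //.
  move=> i j ij; apply: (nxtP (pre i)).2; apply: contra (pN j).
  rewrite !preE => /mapP[k]; rewrite mem_iota => /andP[_ ki] ->.
  by rewrite map_f // mem_iota (leq_trans ki).
move=> k xk; apply: contrapT => np.
have kp n : `|x k| <= `|x (p n)|.
  apply: (nxtP (pre n)).2; rewrite preE; apply/negP => /mapP[i _ e].
  by apply: np; exists i.
have [cp _] := @series_le_bound R (fun n => `|x (p n)|) (l1norm x)
  (fun _ => normr_ge0 _)
  (fun n => @sum_injective_le R (fun k => `|x k|) p n
    (fun _ => normr_ge0 _) lx ip).
have p0 := cvg_series_cvg_0 cp.
have : `|x k| <= limn (fun n => `|x (p n)|).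
  by apply: limr_ge; [apply: cvgP p0 | exact: nearW].
by rewrite (cvg_lim _ p0) // normr_le0; apply/negP.
Qed.

(** Discarding at most [m] terms of a nonincreasing sequence leaves at least
    what remains after discarding the first [m]. *)
Lemma decreasing_tail_sum_le (d : R^nat) (Q : pred nat) m n :
  (forall i, 0 <= d i) -> (forall i j, (i <= j)%N -> d j <= d i) ->
  (count Q (iota 0 n) <= m)%N ->
  \sum_(m <= i < n) d i <= \sum_(0 <= i < n | ~~ Q i) d i.
Proof.
move=> d0 dd; elim: n m => [|n IH] m; first by rewrite !big_geq.
rewrite -addn1 iotaD count_cat /= add0n addn0 addn1 [leRHS]big_mkcond.
rewrite big_nat_recr //= -big_mkcond /=.
case: (Q n) => /=; last first.
  rewrite addn0 => /IH le; have [mn|nm] := leqP m n.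
    by rewrite big_nat_recr //= lerD2r.
  by rewrite big_geq // addr_ge0 // sumr_ge0.
case: m => [|m]; first by rewrite addn1.
rewrite addn1 ltnS addr0 => /IH; apply: le_trans.
by rewrite big_add1 /=; apply: ler_sum => i _; exact: dd.
Qed.

Definition tail (f : R^nat) (n : nat) : R := limn (series f) - series f n.

Lemma tailS (f : R^nat) n : tail f n - tail f n.+1 = f n.
Proof. by rewrite /tail /series /= big_nat_recr //=; ring. Qed.

Lemma tail_le_bound (f : R^nat) m (c : R) : cvgn (series f) ->
  (forall n, \sum_(m <= i < n) f i <= c) -> tail f m <= c.
Proof.
move=> cf fc; rewrite /tail lerBlDr; apply: limr_le => //; near=> n.
have mn : (m <= n)%N by near: n; exact: nbhs_infty_ge.
by rewrite /series /= (big_cat_nat (leq0n m) mn) //= addrC lerD2r.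
Unshelve. all: by end_near. Qed.

Section NonnegativeTail.
Context (f : R^nat) (f0 : forall k, 0 <= f k) (cf : cvgn (series f)).

Lemma tail_ge0 n : 0 <= tail f n.
Proof.
rewrite subr_ge0; apply: nondecreasing_cvgn_le => //.
exact: nondecreasing_series.
Qed.

Lemma tail_le m n : (m <= n)%N -> tail f n <= tail f m.
Proof. by move=> mn; rewrite lerB //; exact: nondecreasing_series. Qed.

Lemma sum_le_tail m n : \sum_(m <= i < n) f i <= tail f m.
Proof.
have [mn|nm] := leqP m n; last by rewrite big_geq ?tail_ge0 // ltnW.
have := tail_ge0 n; rewrite /tail /series /= (big_cat_nat (leq0n m) mn) //=.
by rewrite opprD addrA subr_ge0.
Qed.

Lemma cvg_tail : tail f @ \oo --> 0.
Proof.
rewrite -[X in _ --> X](subrr (limn (series f))).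
by apply: cvgB => //; exact: cvg_cst.
Qed.

End NonnegativeTail.

Section SortedTail.
Context (x : R^nat) (p : nat -> nat).
Context (lx : l1 x) (xp : decreasing_enumeration x p).

Definition sorted_abs : R^nat := fun i => `|x (p i)|.

Lemma sorted_abs_ge0 i : 0 <= sorted_abs i.
Proof. exact: normr_ge0. Qed.

Lemma sorted_abs_summable : cvgn (series sorted_abs).
Proof.
apply: (series_le_bound sorted_abs_ge0 _).1 => n.
exact: (@sum_injective_le R (fun k => `|x k|) p n _ lx (denum_inj xp)).
Qed.

(** Outside the support of [x0] the sequences [x] and [x1] coincide, so [x1]
    carries at least what is left of [x] after removing [m] entries. *)
Lemma sorted_tail_le_decomposition x0 x1 m :
  l0 x0 -> l1 x1 -> x = x0 + x1 -> l0norm x0 = m%:R ->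
  tail sorted_abs m <= l1norm x1.
Proof.
move=> /l0_support[s [us sx ->]] lx1 xE /eqP; rewrite eqr_nat => /eqP <-.
apply: tail_le_bound sorted_abs_summable _ => n.
apply: le_trans (_ : \sum_(0 <= i < n | p i \notin s) sorted_abs i <= _).
  apply: (@decreasing_tail_sum_le _ (fun i => p i \in s)).
  - exact: sorted_abs_ge0.
  - exact: denum_mono xp.
  - rewrite -size_filter -(size_map p) uniq_leq_size //.
      by rewrite (map_inj_uniq (denum_inj xp)) filter_uniq // iota_uniq.
    by move=> k /mapP[i]; rewrite mem_filter => /andP[ps _] ->.
apply: le_trans (_ : \sum_(0 <= i < n) `|x1 (p i)| <= _); last first.
  exact: (@sum_injective_le R (fun k => `|x1 k|) p n _ lx1 (denum_inj xp)).
rewrite big_mkcond; apply: ler_sum => i _; case: ifPn => // pis.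
move: pis; rewrite sx negbK => /eqP pi0.
have -> : sorted_abs i = `|x0 (p i) + x1 (p i)| by rewrite /sorted_abs xE.
by rewrite pi0 add0r.
Qed.

(** The optimal decomposition: [x0] keeps the [n] entries of largest modulus. *)
Lemma exists_sorted_decomposition n : exists x0 x1,
  [/\ l0 x0, l1 x1, x = x0 + x1 &
      l0norm x0 <= n%:R /\ l1norm x1 <= tail sorted_abs n].
Proof.
set s := map p (iota 0 n).
have ps i : (p i \in s) = (i < n)%N.
  by rewrite (mem_map (denum_inj xp)) mem_iota.
pose x0 : R^nat := fun k => if k \in s then x k else 0.
pose x1 : R^nat := fun k => if k \in s then 0 else x k.
have [l0x0 Nx0] : l0 x0 /\ l0norm x0 <= (size s)%:R.
  by apply: l0_le_size => k; rewrite /x0; case: ifP => //; rewrite eqxx.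
have d0 := sorted_abs_ge0; have dc := sorted_abs_summable.
have [cp le] : cvgn (series (fun i => `|x1 (p i)|)) /\
    limn (series (fun i => `|x1 (p i)|)) <= tail sorted_abs n.
  apply: (@series_le_bound R (fun i => `|x1 (p i)|)) => // N.
  apply: le_trans (sum_le_tail d0 dc n N).
  rewrite /series /= (bigID (fun i => (i < n)%N)) /= big1 ?add0r; last first.
    by move=> i ni; rewrite /x1 ps ni normr0.
  have [nN|Nn] := leqP n N; last first.
    rewrite big_nat_cond big1 ?big_geq // 1?ltnW // => i /andP[/andP[_ iN]].
    by rewrite (ltn_trans iN).
  rewrite (big_cat_nat (leq0n n) nN) //= big_nat_cond big1 ?add0r; last first.
    by move=> i /andP[/andP[_ ->]].
  rewrite big_mkcond; apply: ler_sum => i _; rewrite /x1 ps.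
  by case: ltnP => //= _; exact: d0.
have [k|c1 e1] := @reindex_series_nonneg R (fun k => `|x1 k|) p
  (fun _ => normr_ge0 _) (denum_inj xp) _ cp.
  rewrite normr_eq0 /x1; case: ifP; first by rewrite eqxx.
  by move=> _; exact: (denum_support xp).
exists x0, x1; split=> //.
  apply/funext => k; suff : x k = x0 k + x1 k by [].
  by rewrite /x0 /x1; case: ifP => _; rewrite ?addr0 ?add0r.
by move: Nx0; rewrite size_map size_iota; split=> //; rewrite /l1norm e1.
Qed.

End SortedTail.
End DecreasingEnumeration.

(** * From K-functionals to tails, and mass transport between tails *)

Section KFunctional.
Context {R : realType}.
Implicit Types (x b : R^nat) (t : R).

Lemma Kfunctional_le t x x0 x1 : 0 <= t -> l0 x0 -> l1 x1 -> x = x0 + x1 ->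
  Kfunctional t x <= l0norm x0 + t * l1norm x1.
Proof.
move=> t0 l0x l1x xE; apply: ge_inf; last by exists x0, x1.
exists 0 => _ [y0 [y1 [_ ly1 _ ->]]].
by rewrite addr_ge0 // mulr_ge0 // l1norm_ge0.
Qed.

Lemma Kfunctional_nonempty t x : l1 x ->
  [set r | exists x0 x1 : R^nat,
    [/\ l0 x0, l1 x1, x = x0 + x1 & r = l0norm x0 + t * l1norm x1]] !=set0.
Proof.
move=> lx; exists (l0norm (0 : R^nat) + t * l1norm x), 0, x.
by split=> //; [exact: l0_0 | rewrite add0r].
Qed.

Lemma Kfunctional_lt t x c : l1 x -> Kfunctional t x < c ->
  exists x0 x1, [/\ l0 x0, l1 x1, x = x0 + x1 &
    l0norm x0 + t * l1norm x1 < c].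
Proof.
move=> lx /(inf_lt (Kfunctional_nonempty t lx))[_ [x0 [x1 [? ? ? ->]]] ?].
by exists x0, x1.
Qed.

(** The slack [e] makes the inequality strict, hence attained by an actual
    decomposition, and later keeps [tail + e] positive even if [b] has finite
    support. *)
Lemma K_dominated_decomposition C' t n b x (pb px : nat -> nat) e :
  0 < C' -> 0 < t -> 0 < e -> l1 b -> l1 x ->
  decreasing_enumeration b pb -> decreasing_enumeration x px ->
  Kfunctional t x <= C' * Kfunctional t b ->
  exists m : nat, m%:R + t * tail (sorted_abs x px) m <
    C' * (n%:R + t * (tail (sorted_abs b pb) n + e)).
Proof.
move=> C0 t0 e0 lb lx dpb dpx KK.
have [b0 [b1 [l0b l1b bE [Nb0 Nb1]]]] := exists_sorted_decomposition lb dpb n.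
have Kb := Kfunctional_le (ltW t0) l0b l1b bE.
have Kx : Kfunctional t x < C' * (n%:R + t * (tail (sorted_abs b pb) n + e)).
  apply: le_lt_trans KK _; rewrite ltr_pM2l //; apply: le_lt_trans Kb _.
  apply: ler_ltD => //; rewrite ltr_pM2l //.
  by apply: le_lt_trans Nb1 _; rewrite ltrDl.
have [x0 [x1 [l0x l1x xE lt]]] := Kfunctional_lt lx Kx.
have [s [_ _ Nx0]] := l0_support l0x; exists (size s); rewrite -Nx0.
apply: le_lt_trans lt; rewrite lerD2l ler_pM2l //.
exact: (sorted_tail_le_decomposition lx dpx l0x l1x xE Nx0).
Qed.

(** A near-optimal decomposition of [x] at [t = r / (B(n) + e)] satisfies
    [m + t S(m) < C' (n + r)].  For [n > 0] the choice [r = n] bounds [m] by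
    [M n] and [S(m)] by [M (B(n) + e)].  For [n = 0] the choice [r = 1 / C']
    makes the right-hand side equal to [1], which forces [m = 0]. *)
Lemma tails_of_K_domination C' (M : nat) b x (pb px : nat -> nat) :
  0 < C' -> 2 * C' <= M%:R -> l1 b -> l1 x ->
  decreasing_enumeration b pb -> decreasing_enumeration x px ->
  (forall t, 0 < t -> Kfunctional t x <= C' * Kfunctional t b) ->
  forall n, tail (sorted_abs x px) (M * n) <= M%:R * tail (sorted_abs b pb) n.
Proof.
move=> C0 CM lb lx dpb dpx KK n.
have M0 : 0 < M%:R :> R by apply: lt_le_trans CM; rewrite mulr_gt0.
have B0 := tail_ge0 (sorted_abs_ge0 b pb) (sorted_abs_summable lb dpb).
have X0 := tail_ge0 (sorted_abs_ge0 x px) (sorted_abs_summable lx dpx).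
apply/ler_addgt0Pr => d d0; set e := d / M%:R.
have e0 : 0 < e by rewrite divr_gt0.
have -> : M%:R * tail (sorted_abs b pb) n + d =
    M%:R * (tail (sorted_abs b pb) n + e).
  by rewrite [RHS]mulrDr; congr (_ + _); rewrite mulrC divfK // gt_eqF.
set Be := tail _ n + e; have Be0 : 0 < Be by rewrite ltr_wpDl.
have dec r : 0 < r -> exists m : nat,
    m%:R + r / Be * tail (sorted_abs x px) m < C' * (n%:R + r).
  move=> r0; have t0 : 0 < r / Be by rewrite divr_gt0.
  have [m] := K_dominated_decomposition n C0 t0 e0 lb lx dpb dpx (KK _ t0).
  by rewrite -/Be divfK ?gt_eqF //; exists m.
case: n => [|n] in Be Be0 dec *.
  have [m] := dec C'^-1 ltac:(by rewrite invr_gt0).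
  rewrite add0r divff ?gt_eqF // => lt1.
  have m0 : m = 0%N.
    apply/eqP; rewrite -leqn0 -ltnS -(ltr_nat R); apply: le_lt_trans lt1.
    by rewrite lerDl mulr_ge0 // divr_ge0 ?invr_ge0 // ltW.
  rewrite muln0; move: lt1; rewrite m0 add0r mulrAC ltr_pdivrMr // mul1r.
  rewrite ltr_pdivrMl // => /ltW/le_trans; apply; rewrite ler_pM2r //.
  by apply: le_trans CM; rewrite ler_peMl ?ler1n // ltW.
have [m] := dec n.+1%:R ltac:(by []).
rewrite -mulr2n -[_ *+ 2]mulr_natl mulrA [C' * 2]mulrC => lt1.
have lt2 : m%:R + n.+1%:R / Be * tail (sorted_abs x px) m < M%:R * n.+1%:R.
  by apply: lt_le_trans lt1 _; rewrite ler_pM2r.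
have mM : (m <= M * n.+1)%N.
  rewrite ltnW // -(ltr_nat R) natrM; apply: le_lt_trans lt2.
  by rewrite lerDl mulr_ge0 // divr_ge0 // ltW.
apply: le_trans (tail_le (sorted_abs_ge0 x px) mM) _.
have : n.+1%:R / Be * tail (sorted_abs x px) m < M%:R * n.+1%:R.
  by apply: le_lt_trans lt2; rewrite lerDr.
by rewrite mulrAC ltr_pdivrMr // mulrAC [ltRHS]mulrC ltr_pM2l // => /ltW.
Qed.

End KFunctional.

Section Transport.
Context {R : realType}.

Lemma divr_itv01 (u v : R) : 0 <= u <= v -> 0 <= u / v <= 1 /\ u / v * v = u.
Proof.
move=> /andP[u0 uv]; have [v0|v0] := eqVneq v 0.
  have -> : u = 0 by apply/eqP; rewrite eq_le u0 -v0 uv.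
  by rewrite !mul0r lexx ler01.
have vp : 0 < v by rewrite lt_neqAle eq_sym v0 (le_trans u0).
by rewrite divr_ge0 ?(ltW vp) // ler_pdivrMr // mul1r uv divfK.
Qed.

Lemma exists_seq1 (P : nat -> Prop) :
  (forall i j, (i < j)%N -> P i -> P j -> False) ->
  exists2 s : seq nat, (size s <= 1)%N & forall i, P i -> i \in s.
Proof.
move=> Pu; have [[i Pi]|nP] := pselect (exists i, P i).
  exists [:: i] => // j Pj; rewrite inE; apply/eqP.
  by case: (ltngtP i j) => // ij; [case: (Pu i j) | case: (Pu j i)].
by exists [::] => // i Pi; case: nP; exists i.
Qed.

(** [B] and [Z] are tail sums, [B k - B k.+1] and [Z j - Z j.+1] the masses.
    The mass [k] occupies the interval from [B k.+1] to [B k], the mass [j] the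
    interval from [Z j.+1] to [Z j]; as [Z j <= B j], the two can overlap only
    if [j <= k].  Row [j] of [a] is diagonal if the mass [j] of [Z] is at most
    that of [B], and is otherwise given by relative overlaps.  In the latter
    case the interval [j] is longer than each interval [k] that it meets, so
    it contains one of the endpoints of [k]: together with the diagonal entry
    this leaves at most three nonzero entries in column [k]. *)
Lemma exists_transport (B Z : R^nat) :
  (forall i j, (i <= j)%N -> B j <= B i) ->
  (forall i j, (i <= j)%N -> Z j <= Z i) ->
  (forall n, 0 <= Z n <= B n) ->
  (forall i j, (i <= j)%N -> B j - B j.+1 <= B i - B i.+1) ->
  B @ \oo --> 0 ->
  exists a : nat -> nat -> R,
  [/\ forall j k, 0 <= a j k <= 1,
      forall k, exists2 s : seq nat, (size s <= 3)%N &
        forall j, a j k != 0 -> j \in s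
    & forall j,
        series (fun k => a j k * (B k - B k.+1)) @ \oo --> Z j - Z j.+1].
Proof.
move=> Bd Zd ZB bd B0.
pose b k := B k - B k.+1; pose z j := Z j - Z j.+1.
(* [G j k] is the length of the part of the interval [j] below [B k], so that
   [ov j k] is the length of the overlap of the intervals [j] and [k]. *)
pose G j k := Num.min (B k) (Z j) - Num.min (B k) (Z j.+1).
pose ov j k := G j k - G j k.+1.
have ov_itv j k : 0 <= ov j k <= b k.
  have := Bd _ _ (leqnSn k); have := Zd _ _ (leqnSn j).
  by rewrite /ov /G /b /Num.min; do 4 case: ifP; rewrite ?ltNge; lra.
have ov_neq0 j k : ov j k != 0 -> B k.+1 < Z j /\ Z j.+1 < B k.
  have := Bd _ _ (leqnSn k); have := Zd _ _ (leqnSn j) => ZS BS ov0.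
  split; rewrite ltNge; apply: contra ov0 => h; apply/eqP.
    by rewrite /ov /G !min_r ?subrr //; lra.
  by rewrite /ov /G !min_l ?subrr //; lra.
have z0 j : 0 <= z j by rewrite subr_ge0 Zd.
pose a j k := if z j <= b j then (if k == j then z j / b j else 0)
              else ov j k / b k.
exists a; split.
- move=> j k; rewrite /a; case: ifPn => [zb|_].
    case: eqP => // _; last by rewrite lexx ler01.
    by apply: (divr_itv01 _).1; rewrite z0.
  exact: (divr_itv01 (ov_itv j k)).1.
- move=> k.
  have [|s1 S1 H1] := @exists_seq1 (fun j => Z j.+1 <= B k.+1 < Z j).
    move=> i j /Zd ZZ /andP[le _] /andP[_ lt].
    by have := lt_le_trans lt (le_trans ZZ le); rewrite ltxx.
  have [|s2 S2 H2] := @exists_seq1 (fun j => Z j.+1 < B k <= Z j).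
    move=> i j /Zd ZZ /andP[lt _] /andP[_ le].
    by have := le_lt_trans (le_trans le ZZ) lt; rewrite ltxx.
  exists (k :: s1 ++ s2).
    by rewrite /= size_cat ltnS -[2%N]/(1 + 1)%N leq_add.
  move=> j; rewrite /a inE mem_cat; case: ifPn => [_|].
    by case: (eqVneq k j) => [_|_] //=; rewrite eqxx.
  rewrite -ltNge => bz; have [->|] := eqVneq (ov j k) 0.
    by rewrite mul0r eqxx.
  move=> /ov_neq0[BZ ZB'] _; apply/orP; right.
  have jk : (j <= k)%N.
    rewrite leqNgt; apply/negP => kj.
    have /andP[_ ZBj] := ZB j.
    by have := le_trans ZBj (Bd _ _ kj); rewrite leNgt BZ.
  have bkj := bd _ _ jk.
  (* [s1] and [s2] hold the indices [j] whose interval contains the lower and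
     the upper end of the interval [k]. *)
  have [Zk|Zk] := leP (Z j.+1) (B k.+1); first by rewrite H1 ?Zk.
  have [Bk|Bk] := leP (B k) (Z j).
    by rewrite [_ \in s2]H2 ?Bk ?orbT // ZB'.
  by move: bz bkj; rewrite /b /z; lra.
move=> j; rewrite /a; case: (boolP (z j <= b j)) => [zb|_].
  apply: cvg_near_cst; near=> n.
  have jn : (j < n)%N by near: n; exact: nbhs_infty_gt.
  rewrite /series /= (bigD1_seq j) ?iota_uniq ?mem_index_iota //= eqxx.
  rewrite big1 ?addr0; last by move=> k /negPf ->; rewrite mul0r.
  by apply: (divr_itv01 _).2; rewrite z0.
have -> : series (fun k => ov j k / b k * (B k - B k.+1)) =
    (fun n => G j 0%N - G j n).
  apply/funext => n; rewrite /series /=; elim: n => [|n IH].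
    by rewrite big_geq // subrr.
  rewrite big_nat_recr //= IH (divr_itv01 (ov_itv j n)).2.
  by rewrite /ov addrA subrK.
have -> : Z j - Z j.+1 = G j 0%N - 0.
  have ZB0 i : Num.min (B 0%N) (Z i) = Z i.
    by apply/min_idPr; have /andP[_ /le_trans-> //] := ZB i; exact: Bd.
  by rewrite /G !ZB0 subr0.
apply: cvgB; first exact: cvg_cst.
apply: squeeze_cvgr; [|exact: cvg_cst|exact: B0].
apply: nearW => n; have := Zd _ _ (leqnSn j).
have /andP[Zn0 ZBn] := ZB n; have /andP[Zj0 _] := ZB j.+1.
by rewrite /G /Num.min; do 2 case: ifP; rewrite ?ltNge; lra.
Unshelve. all: by end_near. Qed.

End Transport.

(** * An operator sending b to x *)

Section CalderonOperator.
Context {R : realType}.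

Lemma injective_left_inverse (p : nat -> nat) :
  injective p -> exists q, cancel p q.
Proof.
move=> ip; have /choice[q qP] : forall k, exists i, forall j, p j = k -> i = j.
  move=> k; have [[j <-]|np] := pselect (exists j, p j = k).
    by exists j => i /ip.
  by exists 0%N => j pj; case: np; exists j.
by exists q => i; exact: qP.
Qed.

(** The transport matrix between the rearrangement of [b] and the block
    averages of the rearrangement of [x], composed with sorting [b], spreading
    each average over its block and undoing the sorting of [x]. *)
Lemma exists_calderon_matrix (M : nat) (b x : R^nat) (pb px : nat -> nat) :
  (0 < M)%N -> l1 b -> l1 x ->
  decreasing_enumeration b pb -> decreasing_enumeration x px ->
  (forall n,
    tail (sorted_abs x px) (M * n) <= M%:R * tail (sorted_abs b pb) n) ->
  exists A, bounded_columns A (3 * M) /\ mxop A b = x.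
Proof.
move=> M0 lb lx dpb dpx XB.
set B := tail (sorted_abs b pb); set X := tail (sorted_abs x px).
have Mr : 0 < M%:R :> R by rewrite ltr0n.
have b0 := sorted_abs_ge0 b pb; have x0 := sorted_abs_ge0 x px.
have cb := sorted_abs_summable lb dpb; have cx := sorted_abs_summable lx dpx.
pose Z n := X (M * n)%N / M%:R; pose z n := Z n - Z n.+1.
have [||n|i j ij||a [a01 acol arow]] := @exists_transport R B Z.
- by move=> i j ij; exact: tail_le.
- move=> i j ij; rewrite ler_pM2r ?invr_gt0 //.
  by apply: tail_le => //; rewrite leq_mul2l ij orbT.
- by rewrite divr_ge0 ?(ltW Mr) ?tail_ge0 // ler_pdivrMr // mulrC XB.
- by rewrite !tailS; exact: (denum_mono dpb).
- exact: cvg_tail.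
have [qb qbK] := injective_left_inverse (denum_inj dpb).
have [qx qxK] := injective_left_inverse (denum_inj dpx).
have block i : 0 <= sorted_abs x px i <= M%:R * z (i %/ M)%N.
  rewrite x0 /= -(tailS (sorted_abs x px) i) /z /Z -mulrBl mulrC.
  rewrite divfK ?gt_eqF //.
  apply: lerB; apply: tail_le => //; first by rewrite mulnC leq_trunc_div.
  by rewrite mulnC ltn_ceil.
(* [c i] is the share of the [i]-th largest entry of [x] in the average of its
   block, at most [M]. *)
pose c i := M%:R * (sorted_abs x px i / (M%:R * z (i %/ M)%N)).
have c_itv i : 0 <= c i <= M%:R.
  have [/andP[? ?] _] := divr_itv01 (block i).
  by rewrite mulr_ge0 ?(ltW Mr) //= ler_piMr // ltW.
have cz i : c i * z (i %/ M)%N = sorted_abs x px i.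
  by rewrite -[RHS](divr_itv01 (block i)).2 /c; ring.
pose A j k := Num.sg (x j) * Num.sg (b k) *
  (c (qx j) * a (qx j %/ M)%N (qb k)).
have AL : bounded_columns A (3 * M).
  split=> [j k|k].
    have /andP[c0 c1] := c_itv (qx j).
    have /andP[a0 a1] := a01 (qx j %/ M)%N (qb k).
    have sg1 (y : R) : `|Num.sg y| <= 1 by rewrite normr_sg lern1 leq_b1.
    have ca0 := mulr_ge0 c0 a0; rewrite /A 2!normrM (ger0_norm ca0).
    apply: le_trans (_ : 1 * 1 * (M%:R * 1) <= _).
      apply: ler_pM; [by rewrite mulr_ge0|exact: ca0| |exact: ler_pM].
      exact: ler_pM.
    by rewrite !mul1r mulr1 ler_nat leq_pmull.
  have [s s3 sa] := acol (qb k).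
  pose t := [seq px (n * M + r)%N | n <- s, r <- iota 0 M]; exists t.
    by rewrite size_allpairs size_iota leq_mul2r s3 orbT.
  move=> j; rewrite /A !mulf_eq0 !negb_or sgr_eq0.
  move=> /andP[/andP[/(denum_support dpx)[i <-] _] /andP[_]].
  rewrite qxK => /sa is_; apply/allpairsP; exists (i %/ M, i %% M)%N.
  by rewrite /= is_ mem_iota ltn_mod M0 -divn_eq.
exists A; split=> //; apply/funext => j.
have [xj|xj] := eqVneq (x j) 0.
  rewrite xj /mxop (_ : series _ = fun=> 0) ?lim_cst //; apply/funext => n.
  by rewrite /series /= big1 // => k _; rewrite /A xj sgr0 !mul0r.
have [i pij] := denum_support dpx xj.
rewrite /mxop (reindex_series (denum_inj dpb) _ (row_summable AL lb));
  last first.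
  by move=> k; rewrite mulf_eq0 negb_or => /andP[_ /(denum_support dpb)].
have -> : (fun k => A j k * b k) \o pb = (Num.sg (x j) * c i) *:
    ((fun l => a (i %/ M)%N l * (B l - B l.+1)) : R^nat).
  apply/funext => l.
  rewrite -[RHS]/(Num.sg (x j) * c i * (a (i %/ M)%N l * (B l - B l.+1))).
  rewrite /= /A -pij qxK qbK /B tailS -[sorted_abs b pb l]/(`|b (pb l)|).
  by rewrite (normrEsg (b (pb l))); ring.
have ar := arow (i %/ M)%N.
rewrite lim_seriesZ; last by apply: cvgP ar.
rewrite (cvg_lim _ ar) // -[LHS]/(_ * _) -mulrA cz /sorted_abs pij.
by rewrite -numEsg.
Qed.

End CalderonOperator.

(** * Gluing operators, and the two implications *)

Section Gluing.
Context {R : realType}.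
Implicit Types (u : R^nat) (n i j k : nat).

(** The [n]-th of countably many disjoint copies of the index set that
    partition it. *)
Definition in_copy n i : nat := Cantor.to_nat (n, i).

Definition embed n u : R^nat :=
  fun j => let: (m, i) := Cantor.of_nat j in if m == n then u i else 0.

Definition block_diagonal (A : nat -> nat -> nat -> R) (j k : nat) : R :=
  let: (n, i) := Cantor.of_nat j in let: (m, l) := Cantor.of_nat k in
  if n == m then A n i l else 0.

Lemma in_copyK n i : Cantor.of_nat (in_copy n i) = (n, i).
Proof. exact: Cantor.cancel_of_to. Qed.

Lemma in_copy_inj n : injective (in_copy n).
Proof. by move=> i j /(congr1 Cantor.of_nat); rewrite !in_copyK => -[]. Qed.

Lemma in_copy_surj j : exists n i, j = in_copy n i.
Proof.
case e: (Cantor.of_nat j) => [n i]; exists n, i.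
by rewrite /in_copy -e Cantor.cancel_to_of.
Qed.

Lemma embedE n m i u : embed n u (in_copy m i) = if m == n then u i else 0.
Proof. by rewrite /embed in_copyK. Qed.

Lemma block_diagonalE A n m i l :
  block_diagonal A (in_copy n i) (in_copy m l) = if n == m then A n i l else 0.
Proof. by rewrite /block_diagonal !in_copyK. Qed.

Lemma embed_support n u j : embed n u j != 0 -> exists i, in_copy n i = j.
Proof.
have [m [i ->]] := in_copy_surj j; rewrite embedE.
by have [->|] := eqVneq m n; rewrite ?eqxx //; exists i.
Qed.

Lemma level_set_embed n u (s : R) : 0 <= s ->
  [set j | s < `|embed n u j|] = in_copy n @` [set i | s < `|u i|].
Proof.
move=> s0; apply/seteqP; split=> [j /= sj|_ [i /= si <-]].
  have [|i ij] := @embed_support n u j.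
    by rewrite -normr_gt0 (le_lt_trans s0).
  by exists i => //=; move: sj; rewrite -ij embedE eqxx.
by rewrite /= embedE eqxx.
Qed.

Lemma rearrangement_embed n u : rearrangement (embed n u) = rearrangement u.
Proof.
have cardE (s : R) k : 0 <= s ->
    ([set j | s < `|embed n u j|] #<= `I_k)%card =
    ([set i | s < `|u i|] #<= `I_k)%card.
  move=> s0; rewrite (level_set_embed n u s0); apply: card_le_eql.
  by apply: inj_card_eq => i j _ _; exact: in_copy_inj.
apply/funext => k; rewrite /rearrangement; congr (ereal_inf (image _ _)).
by apply/seteqP; split=> s /= [s0]; rewrite cardE.
Qed.

Lemma block_diagonal_bounded A L :
  (forall n, bounded_columns (A n) L) -> bounded_columns (block_diagonal A) L.
Proof.
move=> AL; split=> [j k|k].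
  have [n [i ->]] := in_copy_surj j; have [m [l ->]] := in_copy_surj k.
  rewrite block_diagonalE; case: eqP => _; first exact: (AL n).1.
  by rewrite normr0.
have [m [l ->]] := in_copy_surj k; have [s sL sA] := (AL m).2 l.
exists (map (in_copy m) s); first by rewrite size_map.
move=> j; have [n [i ->]] := in_copy_surj j; rewrite block_diagonalE.
by have [->|_] := eqVneq n m; [move=> /sA; exact: map_f | rewrite eqxx].
Qed.

Lemma mxop_block_diagonal A L n u :
  (forall n, bounded_columns (A n) L) -> l1 (embed n u) ->
  mxop (block_diagonal A) (embed n u) = embed n (mxop (A n) u).
Proof.
move=> AL lu; have GL := block_diagonal_bounded AL.
apply/funext => j; have [m [i ->]] := in_copy_surj j; rewrite embedE.
rewrite /mxop (reindex_series (@in_copy_inj n) _ (row_summable GL lu));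
  last first.
  by move=> k; rewrite mulf_eq0 negb_or => /andP[_ /embed_support].
have [->|mn] := eqVneq m n.
  congr (limn (series _)); apply/funext => l /=.
  by rewrite block_diagonalE embedE eqxx.
rewrite (_ : series _ = fun=> 0) ?lim_cst //; apply/funext => N.
rewrite /series /= big1 // => l _.
by rewrite block_diagonalE (negPf mn) mul0r.
Qed.

End Gluing.

Section InterpolationKMonotone.
Context {R : realType}.

Lemma bounded_homomorphism_le (X : set R^nat) (N : R^nat -> R) T :
  X 0 -> N 0 = 0 -> (forall x, X x -> x <> 0 -> 0 < N x) ->
  bounded_homomorphism X N T ->
  exists c, forall x, X x -> N (T x) <= c * N x.
Proof.
move=> X0 N0 Npos [hT [c cP]]; exists c => x Xx.
have [->|x0] := pselect (x = 0).
  have T0 : T 0 = 0.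
    by apply: (@addrI _ (T 0)); rewrite -(hom_add hT) // !addr0.
  by rewrite T0 N0 mulr0.
by rewrite -ler_pdivrMr ?Npos //; apply: cP; exists x.
Qed.

Lemma qng_gt0 (X : set R^nat) (N : R^nat -> R) x :
  quasi_normed_group X N -> X x -> x <> 0 -> 0 < N x.
Proof.
move=> qX Xx x0; rewrite lt_neqAle (qng_ge0 qX Xx) andbT eq_sym.
by apply/eqP => /(qng_eq0 qX Xx).
Qed.

Lemma Kfunctional_homomorphism (T : R^nat -> R^nat) :
  bounded_homomorphism (@l1 R) (@l1norm R) T ->
  bounded_homomorphism (@l0 R) (@l0norm R) T ->
  exists2 C', 0 < C' & forall x t, l1 x -> 0 < t ->
    Kfunctional t (T x) <= C' * Kfunctional t x.
Proof.
move=> T1 T0.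
have [c1 c1P] := bounded_homomorphism_le l1_0 l1norm0 l1norm_gt0 T1.
have [c0 c0P] := bounded_homomorphism_le l0_0 l0norm0 l0norm_gt0 T0.
pose C' := `|c0| + `|c1| + 1.
have C0 : 0 < C' by rewrite ltr_wpDl // addr_ge0.
have c0C : c0 <= C'.
  by have := ler_norm c0; have := normr_ge0 c1; rewrite /C'; lra.
have c1C : c1 <= C'.
  by have := ler_norm c1; have := normr_ge0 c0; rewrite /C'; lra.
exists C' => // x t lx t0; rewrite -ler_pdivrMl //.
apply: lb_le_inf; first exact: Kfunctional_nonempty.
move=> _ [x0 [x1 [l0x l1x xE ->]]]; rewrite ler_pdivrMl //.
have Tx : T x = T x0 + T x1 by rewrite xE (hom_add T1.1) //; exact: l0_sub_l1.
have KTx := Kfunctional_le (ltW t0) (hom_maps T0.1 l0x) (hom_maps T1.1 l1x) Tx.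
apply: le_trans KTx _.
rewrite mulrDr; apply: lerD.
  by apply: le_trans (c0P _ l0x) _; rewrite ler_wpM2r.
rewrite mulrCA ler_pM2l //; apply: le_trans (c1P _ l1x) _.
by rewrite ler_wpM2r // l1norm_ge0.
Qed.

Lemma Kmonotone_interpolation (X : set R^nat) (N : R^nat -> R) :
  quasi_normed_group X N -> @l0 R `<=` X -> X `<=` @l1 R ->
  (forall C' : R, 0 < C' -> exists C : R, 0 < C /\
     forall b x : R^nat, X b -> l1 x ->
       (forall t : R, 0 < t -> Kfunctional t x <= C' * Kfunctional t b) ->
       X x /\ N x <= C * N b) ->
  interpolation_group X N.
Proof.
move=> qX l0X Xl1 KX; split=> //.
- by move=> x [/l0X].
- by move=> x /Xl1 lx; exists 0; [exact: l0_0 | exists x; rewrite ?add0r].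
move=> T T1 T0; have [C' C'0 KT] := Kfunctional_homomorphism T1 T0.
have [C [_ XC]] := KX _ C'0.
have TX x : X x -> X (T x) /\ N (T x) <= C * N x.
  move=> Xx; have lx := Xl1 _ Xx; apply: XC => //; first exact: (hom_maps T1.1).
  by move=> t; exact: KT.
apply: (@bounded_homomorphismI _ _ _ _ C).
- split=> [x /TX[]//|x y Xx Xy|x Xx].
    by apply: (hom_add T1.1); exact: Xl1.
  by apply: (hom_opp T1.1); exact: Xl1.
- by move=> x; exact: qng_gt0.
- by move=> x /TX[].
Qed.

(** The analogue for the pair [(l0, l1)] of the Calderon-Mityagin theorem. *)
Lemma exists_operator_of_K_domination (C' : R) : 0 < C' -> exists L,
  forall b x : R^nat, l1 b -> l1 x ->
    (forall t : R, 0 < t -> Kfunctional t x <= C' * Kfunctional t b) ->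
    exists A, bounded_columns A L /\ mxop A b = x.
Proof.
move=> C0; pose M := (Num.truncn (2 * C')).+1.
have CM : 2 * C' <= M%:R by rewrite ltW // truncnS_gt.
exists (3 * M)%N => b x lb lx KK.
have [pb dpb] := exists_decreasing_enumeration lb.
have [px dpx] := exists_decreasing_enumeration lx.
apply: (exists_calderon_matrix _ lb lx dpb dpx) => //.
exact: (tails_of_K_domination C0 CM lb lx dpb dpx).
Qed.

(** Uniformity of the constant: a sequence of counterexamples is refuted by the
    single operator obtained by gluing the operators that realise them. *)
Lemma interpolation_Kmonotone (X : set R^nat) (N : R^nat -> R) :
  rearrangement_invariant_group X N -> X `<=` @l1 R ->
  interpolation_group X N ->
  forall C' : R, 0 < C' -> exists C : R, 0 < C /\
     forall b x : R^nat, X b -> l1 x ->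
       (forall t : R, 0 < t -> Kfunctional t x <= C' * Kfunctional t b) ->
       X x /\ N x <= C * N b.
Proof.
move=> X_ri Xl1 iX C' C'0; apply: contrapT => noC.
have qX := rig_qng X_ri.
have [L LP] := exists_operator_of_K_domination C'0.
have /choice[bx bxP] : forall n : nat, exists bx : R^nat * R^nat,
    [/\ X bx.1, l1 bx.2,
      forall t : R, 0 < t -> Kfunctional t bx.2 <= C' * Kfunctional t bx.1 &
      ~ (X bx.2 /\ N bx.2 <= n.+1%:R * N bx.1)].
  move=> n; apply: contrapT => nbx; apply: noC; exists n.+1%:R; split=> //.
  move=> b x Xb lx KK; apply: contrapT => nX; apply: nbx.
  by exists (b, x).
have /choice[A AP] : forall n, exists A,
    bounded_columns A L /\ mxop A (bx n).1 = (bx n).2.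
  by move=> n; have [Xb lx KK _] := bxP n; apply: LP => //; exact: Xl1.
have AL n := (AP n).1.
have [T1 T0] := mxop_bounded (block_diagonal_bounded AL).
have TX := itg_bounded iX T1 T0.
have [c cP] := bounded_homomorphism_le (qng_zero qX)
  ((qng_eq0 qX (qng_zero qX)).2 erefl) (fun x => @qng_gt0 X N x qX) TX.
pose n := Num.truncn c; have [Xb lx _] := bxP n; apply.
have mono u v : rearrangement u = rearrangement v -> X v -> X u /\ N u <= N v.
  by move=> e; apply: (rig_mono X_ri) => k; rewrite e.
have [Xe Ne] := mono _ _ (rearrangement_embed n (bx n).1) Xb.
have TE : mxop (block_diagonal A) (embed n (bx n).1) = embed n (bx n).2.
  by rewrite (mxop_block_diagonal AL (Xl1 _ Xe)) (AP n).2.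
have Xt : X (embed n (bx n).2) by rewrite -TE; exact: (hom_maps TX.1).
have [Xx Nx] := mono _ _ (esym (rearrangement_embed n (bx n).2)) Xt.
split=> //; apply: le_trans Nx _; rewrite -TE; apply: le_trans (cP _ Xe) _.
apply: le_trans (_ : n.+1%:R * N (embed n (bx n).1) <= _).
  by rewrite ler_wpM2r ?(qng_ge0 qX) // ltW // truncnS_gt.
by rewrite ler_wpM2l.
Qed.

End InterpolationKMonotone.

Theorem corollary3 (R : realType) (X : set R^nat) (normX : R^nat -> R)
    (X_ri : rearrangement_invariant_group X normX)
    (l0_X : @l0 R `<=` X) (X_l1 : X `<=` @l1 R) :
  interpolation_group X normX <->
  forall C' : R, 0 < C' ->
    exists C : R, 0 < C /\
      forall b x : R^nat, X b -> l1 x ->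
        (forall t : R, 0 < t -> Kfunctional t x <= C' * Kfunctional t b) ->
        X x /\ normX x <= C * normX b.
Proof.
split; first exact: interpolation_Kmonotone X_ri X_l1.
exact: Kmonotone_interpolation (rig_qng X_ri) l0_X X_l1.
Qed.
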